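(* Let $m>0$, and consider the linearization, as a first-order linear system on $\mathbb{R}^{16}$ in the variables $(x,\dot x)$, of the rotating 4-body equations $$\ddot{x}_i=2\omega J\dot{x}_i+\omega^2 x_i+\frac1{m_i}\sum_{j\ne i}\frac{m_im_j(x_j-x_i)}{|x_j-x_i|^3},\qquad i=1,\dots,4,$$ with $m_1=m_2=m_3=1$, $m_4=m$, $\omega>0$, $\omega^2=\frac{\sqrt3}{3}+m$, at the equilibrium $x=z_0=\left(1,0,-\frac12,\frac{\sqrt3}{2},-\frac12,-\frac{\sqrt3}{2},0,0\right)$, $\dot x=0$. Let $V_1\subset\mathbb{R}^8$ be the span of $z_0$ and $J_4z_0$, and let $V_2=\{(v,v,v,v): v\in\mathbb{R}^2\}\subset\mathbb{R}^8$. Then the four-dimensional subspaces $V_1\times V_1$ and $V_2\times V_2$ of $\mathbb{R}^{16}$ are invariant under the linearization; the eigenvalues on $V_1\times V_1$, counted with multiplicity, are $$0,\quad 0,\quad \frac{\sqrt{3\sqrt3+9m}}{3}\,i,\quad -\frac{\sqrt{3\sqrt3+9m}}{3}\,i,$$ and the eigenvalues on $V_2\times V_2$, counted with multiplicity, are $$\frac{\sqrt{3\sqrt3+9m}}{3}\,i\ \text{(twice)},\qquad -\frac{\sqrt{3\sqrt3+9m}}{3}\,i\ \text{(twice)}.$$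
   Context: This is the planar Newtonian 4-body problem with masses $1,1,1,m$, where $x_i\in\mathbb{R}^2$, $x=(x_1,\dots,x_4)\in\mathbb{R}^8$, $J=\begin{pmatrix}0&1\\-1&0\end{pmatrix}$ and $J_4=\mathrm{diag}(J,J,J,J)$ is the $8\times8$ block-diagonal matrix. The displayed equations are Newton's equations written in uniformly rotating coordinates $q_i=\exp(-\omega Jt)x_i$. The configuration $z_0$ is an equilateral triangle of unit masses with mass $m$ at the center, and is an equilibrium of the rotating system for the given $\omega$. *)

(* Defs.v *)
From HB Require Import structures.
From mathcomp Require Import all_boot all_order all_algebra.
From mathcomp Require Import all_classical all_reals all_analysis.
From mathcomp Require Export complex.

Set Implicit Arguments.
Unset Strict Implicit.
Unset Printing Implicit Defensive.

Import Order.TTheory GRing.Theory Num.Theory.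
Import numFieldNormedType.Exports.

Local Open Scope ring_scope.

(* R^2, R^8 and R^16 are spaces of row vectors, as in the library's jacobian:
   a column-vector action v |-> M v is written v *m M^T, and a linear system
   z' = A z is written z' = z *m A. *)

(* A configuration x = (x_1, .., x_4) is a vector of R^8 = 'rV_(4 * 2),
   listing the coordinates of the four bodies one body after the other.
   Bodies are numbered from 0, so that the body of mass m has index 3. *)
Definition config (R : realType) (f : 'I_4 -> 'rV[R]_2) : 'rV[R]_(4 * 2) :=
  mxvec (\matrix_(i < 4) f i).

Definition body (R : realType) (x : 'rV[R]_(4 * 2)) (i : 'I_4) : 'rV[R]_2 :=
  row i (vec_mx x).

Lemma body_config (R : realType) (f : 'I_4 -> 'rV[R]_2) (i : 'I_4) :
  body (config f) i = f i.
Proof. by rewrite /body /config mxvecK rowK. Qed.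

Definition pt (R : realType) (a b : R) : 'rV[R]_2 := \row_(k < 2) [:: a; b]`_k.

(* The norm of the library on 'rV_2 is the sup norm, not this one. *)
Definition enorm (R : realType) (u : 'rV[R]_2) : R :=
  Num.sqrt (\sum_(k < 2) u 0 k ^+ 2).

Definition Jmx (R : realType) : 'M[R]_2 :=
  \matrix_(i < 2, j < 2) (nth [::] [:: [:: 0; 1]; [:: -1; 0]] i)`_j.

(* v |-> J v *)
Definition rotJ (R : realType) (v : 'rV[R]_2) : 'rV[R]_2 := v *m (Jmx R)^T.

(* x |-> J_4 x, where J_4 = diag(J, J, J, J) *)
Definition rotJ4 (R : realType) (x : 'rV[R]_(4 * 2)) : 'rV[R]_(4 * 2) :=
  config (fun i => rotJ (body x i)).

Definition mass (R : realType) (m : R) (i : 'I_4) : R :=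
  if i == ord_max then m else 1.

Definition acceleration (R : realType) (m omega : R)
    (x v : 'rV[R]_(4 * 2)) (i : 'I_4) : 'rV[R]_2 :=
  (2 * omega) *: rotJ (body v i) + omega ^+ 2 *: body x i
  + (mass m i)^-1 *: \sum_(j < 4 | j != i)
      (mass m i * mass m j / enorm (body x j - body x i) ^+ 3)
        *: (body x j - body x i).

(* The rotating 4-body equations as a first-order system on R^16, in the
   variables z = (x, dx/dt). *)
Definition vector_field (R : realType) (m omega : R)
    (z : 'rV[R]_(4 * 2 + 4 * 2)) : 'rV[R]_(4 * 2 + 4 * 2) :=
  row_mx (rsubmx z) (config (acceleration m omega (lsubmx z) (rsubmx z))).

Definition z0 (R : realType) : 'rV[R]_(4 * 2) :=
  config (fun i => nth 0 [:: pt 1 0;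
                             pt (- (1 / 2)) (Num.sqrt 3 / 2);
                             pt (- (1 / 2)) (- (Num.sqrt 3 / 2));
                             pt 0 0] i).

(* Subspaces are row spaces of matrices. *)

(* span of z0 and J_4 z0 *)
Definition V1 (R : realType) : 'M[R]_(1 + 1, 4 * 2) :=
  col_mx (z0 R) (rotJ4 (z0 R)).

(* The row space of lin1_mx f is the image of the linear map f. *)
Definition V2 (R : realType) : 'M[R]_(2, 4 * 2) :=
  lin1_mx (fun v : 'rV[R]_2 => config (fun=> v)).

Lemma mem_V2 (R : realType) (u : 'rV[R]_(4 * 2)) :
  (u <= V2 R)%MS <-> exists v : 'rV[R]_2, u = config (fun=> v).
Proof.
have VE (v : 'rV[R]_2) : v *m V2 R = config (fun=> v).
  apply/rowP => k; case/mxvec_indexP: k => i j.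
  rewrite [LHS]mxE (bigD1 j) //= big1 => [|l /negPf lj];
    rewrite /config !mxE mxvecE !mxE.
    by rewrite mxvecE !mxE !eqxx mulr1 addr0.
  by rewrite eq_sym lj andbF mulr0.
split=> [/submxP[v ->]|[v ->]]; first by exists v; rewrite VE.
by rewrite -VE submxMl.
Qed.

Definition prodspace (R : realType) (k l n p : nat)
    (V : 'M[R]_(k, n)) (W : 'M[R]_(l, p)) : 'M[R]_(k + l, n + p) :=
  block_mx V 0 0 W.

Lemma mem_prodspace (R : realType) (k l n p : nat)
    (V : 'M[R]_(k, n)) (W : 'M[R]_(l, p)) (v : 'rV[R]_n) (w : 'rV[R]_p) :
  (row_mx v w <= prodspace V W)%MS = (v <= V)%MS && (w <= W)%MS.
Proof.
apply/submxP/andP => [[c]|[/submxP[a ->] /submxP[b ->]]]; last first.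
  by exists (row_mx a b); rewrite mul_row_block !mulmx0 addr0 add0r.
rewrite -[c]hsubmxK mul_row_block !mulmx0 addr0 add0r => /eq_row_mx[-> ->].
by rewrite !submxMl.
Qed.

(* s lists, with algebraic multiplicity, the complex eigenvalues of the
   restriction of A to its invariant subspace U. *)
Definition eigenvalues_on (R : realType) (k n : nat)
    (A : 'M[R]_n) (U : 'M[R]_(k, n)) (s : seq R[i]) : Prop :=
  map_poly (real_complex R) (char_poly (restrictmx U A))
    = \prod_(l <- s) ('X - l%:P).

(* Main.v *)
From HB Require Import structures.
Require Import Defs.
From mathcomp Require Import all_boot all_order all_algebra.
From mathcomp Require Import all_classical all_reals all_analysis.
From mathcomp Require Import ring.

Set Implicit Arguments.
Unset Strict Implicit.
Unset Printing Implicit Defensive.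

Import Order.TTheory GRing.Theory Num.Theory.
Import numFieldNormedType.Exports.

Local Open Scope ring_scope.

(** Newton's acceleration is the sum, over the other bodies, of the field
    [attraction] d / |d|^3 at the relative positions d. Differentiating it shows
    that at a configuration without collisions the linearization is
      (u, w) |-> (w, 2 omega J_4 w + omega^2 u + D f (x) u),
    where D f is a sum of the differentials of that field ([tidal],
    [is_diff_vector_field]). Three properties of D f give everything:
    - the field is homogeneous of degree -2, so D f (x) x = - 2 f (x)
      ([dforce_self]);
    - it is equivariant under rotations, so D f (x) (J_4 x) = J_4 f (x)
      ([dforce_rotJ4]);
    - it only depends on relative positions, so D f (x) vanishes on a common
      translation of all bodies ([dforce_config_cst]).
    The triangle with a mass at its centre is a central configuration:
    f (z0) = - omega^2 z0 ([force_z0]). Hence omega^2 + D f (z0) acts as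
    3 omega^2 on z0, as 0 on J_4 z0, and as omega^2 on translations.

    On each of the two invariant spaces the system therefore has the planar form
      q'' = c J q' + diag (k1, k2) q,   c = 2 omega or c = - 2 omega,
    whose characteristic polynomial is (X^2 - k1) (X^2 - k2) + c^2 X^2
    ([char_poly_gyroscopic]). This is X^2 (X^2 + omega^2) for scalings and
    rotations, (X^2 + omega^2)^2 for translations, and the constant a of the
    theorem is omega. *)

(** * Differentials of vector- and matrix-valued maps *)

Section Differentials.
Context {R : realType}.

Lemma is_diff_big_sum (V W : normedModType R) (I : finType) (P : pred I)
    (f df : I -> V -> W) (x : V) :
  (forall i, P i -> is_diff x (f i) (df i)) ->
  is_diff x (fun z => \sum_(i | P i) f i z) (fun w => \sum_(i | P i) df i w).
Proof.
move=> fdf.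
have -> : (fun z => \sum_(i | P i) f i z) = \sum_(i | P i) f i.
  by apply/funext => z; rewrite fct_sumE.
have -> : (fun z => \sum_(i | P i) df i z) = \sum_(i | P i) df i.
  by apply/funext => z; rewrite fct_sumE.
apply: (big_ind2 (fun g dg => is_diff x g dg)) => //.
- exact: is_diff_cst.
- by move=> g dg h dh; apply: is_diffD.
Qed.

Lemma is_diff_mx (V : normedModType R) m n (f df : V -> 'M[R]_(m, n)) (x : V) :
  (forall i j, is_diff x (fun z => f z i j) (fun w => df w i j)) ->
  is_diff x f df.
Proof.
move=> fdf.
have sumE (g : V -> 'M[R]_(m, n)) :
    g = (fun z => \sum_i \sum_j g z i j *: delta_mx i j).
  by apply/funext => z; rewrite -matrix_sum_delta.
rewrite (sumE f) (sumE df).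
apply: is_diff_big_sum => i _; apply: is_diff_big_sum => j _.
have [dfij dfE] := fdf i j.
by apply: DiffDef; [exact: differentiableZl | rewrite diffZl// dfE].
Qed.

(** Coordinates make a linear map a finite sum of differentiable maps, hence
    continuous; the differential of a continuous linear map is itself. *)
Lemma is_diff_linear n p (f : 'rV[R]_n -> 'rV[R]_p) (x : 'rV[R]_n) :
  linear f -> is_diff x f f.
Proof.
move=> lf.
pose fL := GRing.isLinear.Build R _ _ _ f lf.
pose g : {linear 'rV[R]_n -> 'rV[R]_p} := HB.pack f fL.
have fE : f = (fun z => \sum_i z 0 i *: g (delta_mx 0 i)).
  apply/funext => z; rewrite -[f]/(g : _ -> _) {1}[z]row_sum_delta linear_sum.
  by apply: eq_bigr => i _; rewrite linearZ.
have df y : differentiable f y.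
  rewrite fE -fct_sumE.
  apply: differentiable_sum => i; apply: differentiableZl.
  exact: differentiable_coord.
apply: DiffDef => //; rewrite -[f]/(g : _ -> _); apply: diff_lin.
by move=> y; apply: differentiable_continuous; apply: df.
Qed.

Lemma is_diff_coord (V : normedModType R) m n (f df : V -> 'M[R]_(m, n))
    (x : V) i j :
  is_diff x f df -> is_diff x (fun z => f z i j) (fun w => df w i j).
Proof.
move=> fdf; pose c (N : 'M[R]_(m, n)) := N i j.
have lc : linear (c : _ -> R^o) by move=> a u v; rewrite /c !mxE.
pose cL := GRing.isLinear.Build R _ _ _ (c : _ -> R^o) lc.
pose g : {linear 'M[R]_(m, n) -> R^o} := HB.pack (c : _ -> R^o) cL.
have dc y : is_diff y (c : _ -> R^o) (c : _ -> R^o).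
  apply: DiffDef; first exact: differentiable_coord.
  rewrite -[c]/(g : _ -> _); apply: diff_lin.
  exact: coord_continuous.
exact: (@is_diff_comp _ _ _ _ f df c c x fdf (dc _)).
Qed.

Lemma is_diff_config (V : normedModType R) (f df : V -> 'I_4 -> 'rV[R]_2)
    (z : V) : (forall i, is_diff z (f^~ i) (df^~ i)) ->
  is_diff z (fun t => config (f t)) (fun w => config (df w)).
Proof.
move=> fdf; apply: is_diff_mx => i k; rewrite ord1.
case/mxvec_indexP: k => k l.
have cE (g : V -> 'I_4 -> 'rV[R]_2) :
    (fun t => config (g t) 0 (mxvec_index k l)) = (fun t => g t k 0 l).
  by apply/funext => t; rewrite mxvecE mxE.
by rewrite !cE; apply: is_diff_coord (fdf k).
Qed.

Lemma is_diff_row_mx (V : normedModType R) n p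
    (f df : V -> 'rV[R]_n) (g dg : V -> 'rV[R]_p) (z : V) :
  is_diff z f df -> is_diff z g dg ->
  is_diff z (fun t => row_mx (f t) (g t)) (fun w => row_mx (df w) (dg w)).
Proof.
move=> fdf gdg; apply: is_diff_mx => i k; case: (split_ordP k) => j ->.
  have rE (f1 : V -> 'rV[R]_n) (g1 : V -> 'rV[R]_p) :
      (fun t => row_mx (f1 t) (g1 t) i (lshift p j)) = (fun t => f1 t i j).
    by apply/funext => t; rewrite row_mxEl.
  by rewrite !rE; apply: is_diff_coord.
have rE (f1 : V -> 'rV[R]_n) (g1 : V -> 'rV[R]_p) :
    (fun t => row_mx (f1 t) (g1 t) i (rshift n j)) = (fun t => g1 t i j).
  by apply/funext => t; rewrite row_mxEr.
by rewrite !rE; apply: is_diff_coord.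
Qed.

End Differentials.

(** * The attraction and its first variation *)

Section Force.
Context {R : realType}.
Implicit Types (d w u v : 'rV[R]_2) (x y : 'rV[R]_(4 * 2)) (m omega : R).

Definition dot u v : R := \sum_(k < 2) u 0 k * v 0 k.

Lemma enorm_sqr d : enorm d ^+ 2 = dot d d.
Proof.
rewrite sqr_sqrtr; last by apply: sumr_ge0 => k _; exact: sqr_ge0.
by apply: eq_bigr => k _; rewrite expr2.
Qed.

Definition attraction d : 'rV[R]_2 := (enorm d ^+ 3)^-1 *: d.

(** The differential of the attraction at d, applied to w. *)
Definition tidal d w : 'rV[R]_2 :=
  (enorm d ^+ 3)^-1 *: w - (3 * dot d w / enorm d ^+ 5) *: d.

(** The norm is the square root, differentiable away from 0, of [dot d d]. *)
Lemma is_diff_enorm d : enorm d != 0 ->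
  is_diff d (@enorm R) (fun w => dot d w / enorm d).
Proof.
move=> d0.
have sq : is_diff d (fun u => \sum_(k < 2) u 0 k ^+ 2) (fun w => 2 * dot d w).
  have cd k : is_diff d (fun u : 'rV[R]_2 => u 0 k ^+ 2)
      (fun w => 2 * (d 0 k * w 0 k)).
    have ck := @is_diff_coord R _ 1 2 id id d 0 k (is_diff_id d).
    apply: is_diff_eq (is_diffX 1 ck) _; apply/funext => w /=.
    by do 2!rewrite /GRing.scale/=; ring.
  apply: is_diff_eq (is_diff_big_sum (fun k _ => cd k)) _.
  by apply/funext => w; rewrite -mulr_sumr.
have d2 : 0 < \sum_(k < 2) d 0 k ^+ 2 by rewrite -sqrtr_gt0 lt_def d0 sqrtr_ge0.
have sd : is_diff (\sum_(k < 2) d 0 k ^+ 2) (Num.sqrt : R -> R)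
    (fun t => t / (2 * enorm d)).
  have [ds dE] := is_derive1_sqrt d2.
  by apply: DiffDef; [exact/derivable1_diffP | rewrite deriv1E// derive1E dE].
apply: is_diff_eq (@is_diff_comp _ _ _ _ _ _ _ _ d sq sd) _.
by apply/funext => w /=; field.
Qed.

Lemma is_diff_attraction d : enorm d != 0 ->
  is_diff d attraction (tidal d).
Proof.
move=> d0; have nd := is_diff_enorm d0.
have n3 := is_diffX 2 nd.
have [dn3 dn3E] := n3.
have d30 : (@enorm R ^+ 3) d != 0 by exact: (expf_neq0 3 d0).
have i3 : is_diff d (fun u => (enorm u ^+ 3)^-1)
    (fun w => - 3 * dot d w / enorm d ^+ 5).
  apply: DiffDef; first exact: (differentiableV dn3 d30).
  rewrite (diffV dn3 d30) dn3E.
  (* The two sides are convertible, but field does not see through the power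
     of a function. *)
  have e3 : (@enorm R ^+ 3) d = enorm d ^+ 3 by [].
  by rewrite e3; apply/funext => w /=; do 2!rewrite /GRing.scale/=; field.
apply: is_diff_mx => i k; rewrite ord1.
have ck := @is_diff_coord R _ 1 2 id id d 0 k (is_diff_id d).
have -> : (fun z => attraction z 0 k)
    = (fun u => (enorm u ^+ 3)^-1) * (fun u => u 0 k).
  by apply/funext => u; rewrite mxE.
apply: is_diff_eq (is_diffM i3 ck) _.
apply/funext => w.
rewrite -[LHS]/((enorm d ^+ 3)^-1 * w 0 k
                + d 0 k * (- 3 * dot d w / enorm d ^+ 5)).
by rewrite !mxE; ring.
Qed.

Lemma rotJE v : rotJ v = pt (v 0 1) (- v 0 0).
Proof.
apply/rowP => k; rewrite !mxE !big_ord_recl big_ord0 !mxE.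
have -> : lift ord0 ord0 = 1 :> 'I_2 by exact/val_inj.
by case: k => [[|[|//]]] ? /=; rewrite !(mulr0, mulr1, mulrN1, add0r, addr0).
Qed.

Lemma dot_rotJ d : dot d (rotJ d) = 0.
Proof.
rewrite /dot rotJE !big_ord_recl big_ord0 !mxE /=.
rewrite (_ : lift _ _ = 1); last exact/val_inj.
by ring.
Qed.

Lemma tidal0 d : tidal d 0 = 0.
Proof.
rewrite /tidal /dot big1 => [|k _]; last by rewrite mxE mulr0.
by rewrite mulr0 mul0r scaler0 scale0r subr0.
Qed.

(** Euler's identity for a field homogeneous of degree -2. *)
Lemma tidal_self d : enorm d != 0 -> tidal d d = - 2 *: attraction d.
Proof.
move=> d0; rewrite /tidal /attraction -enorm_sqr -scalerBl scalerA.
by congr (_ *: _); field.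
Qed.

(** The infinitesimal form of the equivariance of the attraction under
    rotations: J d is orthogonal to d, so the radial term vanishes. *)
Lemma tidal_rotJ d : tidal d (rotJ d) = rotJ (attraction d).
Proof.
by rewrite /tidal dot_rotJ mulr0 mul0r scale0r subr0 /rotJ -scalemxAl.
Qed.

(** The acceleration of body i due to the other bodies; its own mass has
    cancelled. *)
Definition force m x (i : 'I_4) : 'rV[R]_2 :=
  \sum_(j < 4 | j != i) mass m j *: attraction (body x j - body x i).

(** The differential of the force at x, applied to y. *)
Definition dforce m x y (i : 'I_4) : 'rV[R]_2 :=
  \sum_(j < 4 | j != i)
    mass m j *: tidal (body x j - body x i) (body y j - body y i).

Lemma accelerationE m omega x y i : m != 0 ->
  acceleration m omega x y i
  = (2 * omega) *: rotJ (body y i) + omega ^+ 2 *: body x i + force m x i.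
Proof.
move=> m0.
have mi0 : mass m i != 0.
  by rewrite /mass; case: ifP; rewrite ?oner_eq0.
congr (_ + _); rewrite scaler_sumr; apply: eq_bigr => j _.
by rewrite !scalerA; congr (_ *: _); rewrite -!mulrA mulKf.
Qed.

(** * The linearization at a configuration without collisions *)

Lemma body_is_linear i : linear (@body R ^~ i).
Proof. by move=> a x y; rewrite /body !linearP. Qed.

Lemma rotJ_is_linear : linear (@rotJ R).
Proof. by move=> a u v; rewrite /rotJ mulmxDl scalemxAl. Qed.

Definition dvector_field m omega x (z : 'rV[R]_(4 * 2 + 4 * 2)) :
    'rV[R]_(4 * 2 + 4 * 2) :=
  row_mx (rsubmx z)
    (config (fun i => (2 * omega) *: rotJ (body (rsubmx z) i)
       + omega ^+ 2 *: body (lsubmx z) i + dforce m x (lsubmx z) i)).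

Definition collision_free x :=
  forall i j : 'I_4, j != i -> enorm (body x j - body x i) != 0.

Lemma is_diff_vector_field m omega x y : m != 0 -> collision_free x ->
  is_diff (row_mx x y) (vector_field m omega) (dvector_field m omega x).
Proof.
move=> m0 xcf.
apply: is_diff_row_mx.
  by apply: is_diff_linear => a b z; rewrite linearP.
apply: is_diff_config => i.
have -> : (fun z : 'rV[R]_(4 * 2 + 4 * 2) =>
    acceleration m omega (lsubmx z) (rsubmx z) i) =
  (fun z => (2 * omega) *: rotJ (body (rsubmx z) i)
            + omega ^+ 2 *: body (lsubmx z) i + force m (lsubmx z) i).
  by apply/funext => z; rewrite accelerationE.
have bl j : is_diff (row_mx x y)
    (fun z : 'rV[R]_(4 * 2 + 4 * 2) => body (lsubmx z) j)
    (fun z => body (lsubmx z) j).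
  by apply: is_diff_linear => a b z; rewrite linearP body_is_linear.
apply: is_diffD.
  apply: is_diff_linear => a b z.
  rewrite !linearP !body_is_linear rotJ_is_linear !scalerDr !scalerA.
  by rewrite addrACA /= !scalerA !(mulrC a).
apply: is_diff_big_sum => j ji; apply: is_diffZ.
have dij : is_diff (row_mx x y)
    (fun z : 'rV[R]_(4 * 2 + 4 * 2) => body (lsubmx z) j - body (lsubmx z) i)
    (fun z => body (lsubmx z) j - body (lsubmx z) i).
  exact: is_diffB.
apply: (is_diff_comp dij); rewrite row_mxKl.
exact: is_diff_attraction (xcf _ _ ji).
Qed.

End Force.

Section Linearization.
Context {R : realType}.
Implicit Types (x y v : 'rV[R]_(4 * 2)) (m omega c : R).

Lemma dforce_self m x i : collision_free x ->
  dforce m x x i = - 2 *: force m x i.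
Proof.
move=> xcf; rewrite scaler_sumr; apply: eq_bigr => j ji.
by rewrite tidal_self; [rewrite scalerA mulrC -scalerA | exact: xcf].
Qed.

Lemma dforce_rotJ4 m x i : dforce m x (rotJ4 x) i = rotJ (force m x i).
Proof.
rewrite /rotJ mulmx_suml; apply: eq_bigr => j _.
rewrite !body_config -scalemxAl -[_ *m _]/(rotJ _) -tidal_rotJ.
by rewrite /rotJ mulmxBl.
Qed.

Lemma dforce_config_cst m x (v : 'rV[R]_2) i :
  dforce m x (config (fun=> v)) i = 0.
Proof.
by apply: big1 => j _; rewrite !body_config subrr tidal0 scaler0.
Qed.

Lemma config_eq (f : 'I_4 -> 'rV[R]_2) x :
  (forall i, f i = body x i) -> config f = x.
Proof.
move=> fx; rewrite /config -[RHS]vec_mxK; congr mxvec.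
by apply/row_matrixP => i; rewrite rowK fx.
Qed.

Lemma bodyZ c x i : body (c *: x) i = c *: body x i.
Proof. by rewrite /body !linearZ. Qed.

Lemma body0 i : body (0 : 'rV[R]_(4 * 2)) i = 0.
Proof. by rewrite /body !linear0. Qed.

Lemma body_rotJ4 x i : body (rotJ4 x) i = rotJ (body x i).
Proof. exact: body_config. Qed.

Lemma rotJZ c (v : 'rV[R]_2) : rotJ (c *: v) = c *: rotJ v.
Proof. by rewrite /rotJ scalemxAl. Qed.

Lemma trmx_Jmx : (Jmx R)^T = - Jmx R.
Proof.
by apply/matrixP => -[[|[|//]]] ? -[[|[|//]]] ?; rewrite !mxE /= ?oppr0 ?opprK.
Qed.

Lemma rotJK (v : 'rV[R]_2) : rotJ (rotJ v) = - v.
Proof.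
rewrite !rotJE !mxE; apply/rowP => -[[|[|//]]] ?; rewrite !mxE /=;
  by congr (- v _ _); exact/val_inj.
Qed.

Lemma rotJ4K x : rotJ4 (rotJ4 x) = - x.
Proof.
by apply: config_eq => i; rewrite body_config rotJK /body !linearN.
Qed.

Lemma rotJ0 : rotJ (0 : 'rV[R]_2) = 0.
Proof. by rewrite /rotJ mul0mx. Qed.

(** Eigenvectors of the first variation of the force are what makes subspaces
    of the form V x V invariant. *)
Lemma jacobian_position m omega x y v c : m != 0 -> collision_free x ->
  (forall i, dforce m x v i = c *: body v i) ->
  row_mx v 0 *m jacobian (vector_field m omega) (row_mx x y)
  = row_mx 0 ((omega ^+ 2 + c) *: v).
Proof.
move=> m0 xcf vc; have [dF dFE] := is_diff_vector_field omega y m0 xcf.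
rewrite -deriveEjacobian// deriveE// dFE /dvector_field row_mxKl row_mxKr.
congr row_mx; apply: config_eq => i.
by rewrite vc body0 rotJ0 scaler0 add0r bodyZ scalerDl.
Qed.

Lemma jacobian_velocity m omega x y v : m != 0 -> collision_free x ->
  row_mx 0 v *m jacobian (vector_field m omega) (row_mx x y)
  = row_mx v ((2 * omega) *: rotJ4 v).
Proof.
move=> m0 xcf; have [dF dFE] := is_diff_vector_field omega y m0 xcf.
rewrite -deriveEjacobian// deriveE// dFE /dvector_field row_mxKl row_mxKr.
congr row_mx; apply: config_eq => i.
rewrite body0 scaler0 addr0 bodyZ body_config.
by rewrite /dforce big1 ?addr0// => j _; rewrite !body0 subrr tidal0 scaler0.
Qed.

End Linearization.

(** * Characteristic polynomials on invariant subspaces *)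

Section LinearAlgebra.
Context {F : fieldType}.

(** Here r is a rank, equal to k but not convertible to it. *)
Lemma char_poly_conj k r (P : 'M[F]_(k, r)) (Q : 'M[F]_(r, k)) (B : 'M[F]_k) :
  r = k -> P *m Q = 1%:M -> char_poly (Q *m B *m P) = char_poly B.
Proof.
move=> rk; subst r => PQ1; have QP1 := mulmx1C PQ1.
have PQp : map_mx polyC P *m map_mx polyC Q = 1%:M.
  by rewrite -map_mxM PQ1 map_mx1.
have QPp : map_mx polyC Q *m map_mx polyC P = 1%:M by apply: mulmx1C.
rewrite /char_poly /char_poly_mx !map_mxM.
have -> : 'X%:M - map_mx polyC Q *m map_mx polyC B *m map_mx polyC P
    = map_mx polyC Q *m ('X%:M - map_mx polyC B) *m map_mx polyC P.
  by rewrite mulmxBr mulmxBl mul_mx_scalar -scalemxAl QPp scalemx1.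
by rewrite !det_mulmx mulrAC -det_mulmx QPp det1 mul1r.
Qed.

(** The restriction to U is computed in the basis that the library chooses for
    the row space of U; the rows of U are another basis, so the two matrices are
    conjugate. *)
Lemma char_poly_restrictmx k n (A : 'M[F]_n) (U : 'M[F]_(k, n)) (B : 'M[F]_k) :
  row_free U -> U *m A = B *m U -> char_poly (restrictmx U A) = char_poly B.
Proof.
move=> Ufree UA; pose Q := row_base U *m pinvmx U.
have QU : Q *m U = row_base U by rewrite mulmxKpV// eq_row_base.
have PU : U *m pinvmx (row_base U) *m row_base U = U.
  by rewrite mulmxKpV// eq_row_base.
rewrite /conjmx -{1}QU -(mulmxA Q) UA mulmxA -(mulmxA (Q *m B)).
apply: char_poly_conj; first exact/eqP.
by apply: (row_free_inj Ufree); rewrite -mulmxA QU PU mul1mx.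
Qed.

(** The block matrix is the companion of q'' = S q' + K q. Multiplying its
    characteristic matrix on the right by a lower triangular block matrix with
    diagonal blocks X - S and 1 makes it upper triangular, with diagonal blocks
    X^2 - X S - K and X - S; the determinant of X - S is monic and cancels. *)
Lemma char_poly_second_order k (K S : 'M[F]_k) :
  char_poly (block_mx 0 K 1%:M S)
  = \det (('X ^+ 2)%:M - 'X *: map_mx polyC S - map_mx polyC K).
Proof.
apply: (mulIf (monic_neq0 (char_poly_monic S))).
have <- : \det (block_mx (char_poly_mx S) 0 1%:M 1%:M) = char_poly S.
  by rewrite det_lblock det1 mulr1.
rewrite /char_poly -det_mulmx /char_poly_mx map_block_mx scalar_mx_block.
rewrite opp_block_mx add_block_mx mulmx_block !map_mx0 map_mx1.
rewrite !mulmx1 !mulmx0 !add0r !subr0 mulNmx mul1mx addNr.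
rewrite det_ublock det_lblock det1 mulr1; congr (\det _ * _).
by rewrite mul_scalar_mx scalerBr scale_scalar_mx.
Qed.

Lemma det_mx2 (T : comNzRingType) (M : 'M[T]_2) :
  \det M = M 0 0 * M 1 1 - M 0 1 * M 1 0.
Proof.
rewrite (expand_det_row _ 0) !big_ord_recl big_ord0 addr0.
rewrite /cofactor !det_mx11 !mxE /= expr0 expr1 mul1r mulN1r mulrN.
by congr (M _ _ * M _ _ - M _ _ * M _ _); exact/val_inj.
Qed.

End LinearAlgebra.

Section SecondOrder.
Context {R : realType}.
Implicit Types a b c : R.

Lemma rank_prodspace k n (V : 'M[R]_(k, n)) : row_free V ->
  \rank (prodspace V V) = (k + k)%N.
Proof. by move=> /eqP rV; rewrite rank_diag_block_mx rV. Qed.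

Lemma char_poly_gyroscopic a b c :
  char_poly (block_mx 0 (diag_mx (pt a b)) 1%:M (c *: Jmx R))
  = ('X ^+ 2 - a%:P) * ('X ^+ 2 - b%:P) + 'X ^+ 2 * c%:P ^+ 2.
Proof.
rewrite char_poly_second_order det_mx2 !mxE /=.
rewrite !(mulr0n, mulr1n, mulr0, mulr1, mulrN1, polyC0, polyCN).
ring.
Qed.

(** K is the matrix, in the basis V, of the map from positions to
    accelerations, and S that of the map from velocities to accelerations. *)
Lemma prodspace_stable k n (A : 'M[R]_(n + n)) (V : 'M[R]_(k, n))
    (K S : 'M[R]_k) :
  row_mx V 0 *m A = row_mx 0 (K *m V) ->
  row_mx 0 V *m A = row_mx V (S *m V) ->
  prodspace V V *m A = block_mx 0 K 1%:M S *m prodspace V V.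
Proof.
move=> VK VS.
rewrite {1}/prodspace {1}/block_mx mul_col_mx VK VS mulmx_block.
by rewrite !mulmx0 !mul0mx !addr0 !add0r mul1mx.
Qed.

Lemma eigenvalues_prodspace n (A : 'M[R]_(n + n)) (V : 'M[R]_(2, n)) K S s :
  row_free V ->
  row_mx V 0 *m A = row_mx 0 (K *m V) ->
  row_mx 0 V *m A = row_mx V (S *m V) ->
  map_poly (real_complex R) (char_poly (block_mx 0 K 1%:M S))
    = \prod_(l <- s) ('X - l%:P) ->
  [/\ stablemx (prodspace V V) A & eigenvalues_on A (prodspace V V) s].
Proof.
move=> Vfree VK VS ps; have UA := prodspace_stable VK VS.
split; first by rewrite UA submxMl.
rewrite /eigenvalues_on (char_poly_restrictmx _ UA) ?ps//.
by rewrite /row_free rank_prodspace.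
Qed.

End SecondOrder.

(** * The triangle with a central mass *)

Section Triangle.
Context {R : realType}.
Implicit Types (a b c m : R).

Lemma ptD a b a' b' : pt a b + pt a' b' = pt (a + a') (b + b').
Proof. by apply/rowP => -[[|[|//]]] ?; rewrite !mxE. Qed.

Lemma ptN a b : - pt a b = pt (- a) (- b).
Proof. by apply/rowP => -[[|[|//]]] ?; rewrite !mxE. Qed.

Lemma ptZ c a b : c *: pt a b = pt (c * a) (c * b).
Proof. by apply/rowP => -[[|[|//]]] ?; rewrite !mxE. Qed.

Lemma enorm_pt a b c : 0 <= c -> a ^+ 2 + b ^+ 2 = c ^+ 2 -> enorm (pt a b) = c.
Proof.
move=> c0 abc.
by rewrite /enorm !big_ord_recl big_ord0 !mxE /= addr0 abc sqrtr_sqr ger0_norm.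
Qed.

Lemma sqr_sqrt3 : Num.sqrt 3 ^+ 2 = 3 :> R.
Proof. by rewrite sqr_sqrtr// ler0n. Qed.

Lemma sqrt3_neq0 : Num.sqrt 3 != 0 :> R.
Proof. by rewrite gt_eqF// sqrtr_gt0 ltr0n. Qed.

(** The side of an equilateral triangle of circumradius 1 is sqrt 3; the last
    body is at the centre. *)
Lemma enorm_z0 (i j : 'I_4) : j != i ->
  enorm (body (z0 R) j - body (z0 R) i)
  = if (i == ord_max) || (j == ord_max) then 1 else Num.sqrt 3.
Proof.
have s2 := sqr_sqrt3; rewrite !body_config.
case: i j => [[|[|[|[|//]]]] ?] [[|[|[|[|//]]]] ?] //= _;
  by rewrite ptN ptD; apply: enorm_pt; rewrite ?ler01 ?sqrtr_ge0//; field: s2.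
Qed.

Lemma collision_free_z0 : collision_free (z0 R).
Proof.
by move=> i j ji; rewrite enorm_z0//; case: ifP; rewrite ?oner_eq0// sqrt3_neq0.
Qed.

(** The vertices z_j of the triangle sum to 0, so those other than z_i attract
    the body at z_i by - 3 z_i / (sqrt 3)^3 = - (sqrt 3 / 3) z_i; the central
    body adds - m z_i, and is itself attracted by the sum of the z_j, which
    is 0. *)
Lemma force_z0 m i :
  force m (z0 R) i = - (Num.sqrt 3 / 3 + m) *: body (z0 R) i.
Proof.
have s2 := sqr_sqrt3; have s0 := sqrt3_neq0.
have s3 : (Num.sqrt 3 ^+ 3)^-1 = Num.sqrt 3 / 9 :> R.
  by rewrite exprS s2; field: s2.
rewrite /force.
rewrite (eq_bigr (fun j : 'I_4 =>
    (if (i == ord_max) || (j == ord_max) then mass m j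
     else mass m j * Num.sqrt 3 / 9) *: (body (z0 R) j - body (z0 R) i))).
  rewrite big_mkcond !big_ord_recl big_ord0 !body_config.
  by case: i => [[|[|[|[|//]]]] ?]; rewrite /mass /=;
    rewrite !(ptN, ptD, ptZ, addr0, add0r); congr pt; field.
move=> j ji; rewrite /attraction enorm_z0// scalerA; congr (_ *: _).
by case: ifP; rewrite ?expr1n ?invr1 ?mulr1// s3 mulrA.
Qed.

End Triangle.

(** * Bases of scalings, rotations and translations *)

Section Bases.
Context {R : realType}.

Lemma row_mul2 n (K : 'M[R]_2) (V : 'M[R]_(2, n)) i :
  row i (K *m V) = K i 0 *: row 0 V + K i 1 *: row 1 V.
Proof.
rewrite row_mul mulmx_sum_row !big_ord_recl big_ord0 addr0 !mxE.
by have -> : lift ord0 ord0 = 1 :> 'I_2 by exact/val_inj.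
Qed.

Lemma row_V1_0 : row 0 (V1 R) = z0 R.
Proof.
transitivity (row (lshift 1 0) (V1 R)); first by congr row; exact/val_inj.
by rewrite /V1 rowKu row_id.
Qed.

Lemma row_V1_1 : row 1 (V1 R) = rotJ4 (z0 R).
Proof.
transitivity (row (rshift 1 0) (V1 R)); first by congr row; exact/val_inj.
by rewrite /V1 rowKd row_id.
Qed.

Lemma row_V2 i : row i (V2 R) = config (fun=> delta_mx 0 i).
Proof. by apply/rowP => k; rewrite !mxE. Qed.

Lemma mul_V2 (v : 'rV[R]_2) : v *m V2 R = config (fun=> v).
Proof.
rewrite mulmx_sum_row; symmetry; apply: config_eq => i.
rewrite !big_ord_recl big_ord0 addr0 body_is_linear bodyZ !row_V2 !body_config.
apply/rowP => -[[|[|//]]] ?; rewrite !mxE /= !(mulr1, mulr0, addr0, add0r);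
  by congr (v _ _); apply/val_inj.
Qed.

Lemma V1_free : row_free (V1 R).
Proof.
(* The first body is at (1, 0) in z0 and at (0, -1) in J_4 z0. *)
apply: inj_row_free => v vV.
have : body (row 0 (v *m V1 R)) 0 = 0 by rewrite vV row0 body0.
rewrite row_id mulmx_sum_row !big_ord_recl big_ord0 addr0.
rewrite (_ : lift ord0 ord0 = 1); last exact/val_inj.
rewrite row_V1_0 row_V1_1 body_is_linear bodyZ !body_config /= rotJE !mxE /=.
rewrite !(ptZ, ptD) => /rowP v0.
apply/rowP => -[[|[|//]]] p; rewrite mxE.
  have := v0 0; rewrite !mxE /= !(mulr1, mulr0, oppr0, addr0) => <-.
  by congr (v _ _); apply/val_inj.
have := v0 1; rewrite !mxE /= !(mulr0, mulrN1, add0r) => /eqP.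
rewrite oppr_eq0 => /eqP <-.
by congr (v _ _); apply/val_inj.
Qed.

Lemma V2_free : row_free (V2 R).
Proof.
apply: inj_row_free => v; rewrite mul_V2 => /(congr1 (@body R ^~ 0)).
by rewrite body_config body0.
Qed.

End Bases.

(** * The spectra on the two invariant spaces *)

Section Spectrum.
Context {R : realType}.
Implicit Types (m omega : R).

Lemma char_poly_iomega omega :
  map_poly (real_complex R) ('X ^+ 2 + (omega ^+ 2)%:P)
  = ('X - ((0 +i* omega)%C)%:P) * ('X - ((0 -i* omega)%C)%:P).
Proof.
rewrite rmorphD rmorphXn/= map_polyX map_polyC /=.
have -> : ((0 -i* omega)%C : R[i]) = - (0 +i* omega)%C.
  by apply/eqP; rewrite eq_complex /= oppr0 !eqxx.
have -> : real_complex R (omega ^+ 2) = - ((0 +i* omega)%C ^+ 2).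
  by rewrite !expr2; apply/eqP; rewrite eq_complex /=;
    apply/andP; split; apply/eqP; ring.
by rewrite !polyCN polyC_exp; ring.
Qed.

Lemma spectrum_V1 m omega : m != 0 -> omega ^+ 2 = Num.sqrt 3 / 3 + m ->
  let A := jacobian (vector_field m omega) (row_mx (z0 R) 0) in
  stablemx (prodspace (V1 R) (V1 R)) A /\
  eigenvalues_on A (prodspace (V1 R) (V1 R))
    [:: 0; 0; (0 +i* omega)%C; (0 -i* omega)%C].
Proof.
move=> m0 omega_sq A.
have cf := @collision_free_z0 R.
have fz i : force m (z0 R) i = - omega ^+ 2 *: body (z0 R) i.
  by rewrite omega_sq force_z0.
have i2 (i : 'I_2) : i = 0 \/ i = 1.
  by case: i => [[|[|//]]] ?; [left|right]; exact/val_inj.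
have [||| //] := @eigenvalues_prodspace R 8 A (V1 R)
    (diag_mx (pt (3 * omega ^+ 2) 0)) ((2 * omega) *: Jmx R)
    [:: 0; 0; (0 +i* omega)%C; (0 -i* omega)%C] V1_free.
- apply/row_matrixP => i; rewrite row_mul !row_row_mx !row0 row_mul2 !mxE.
  case: (i2 i) => ->; rewrite ?row_V1_0 ?row_V1_1 /=;
    rewrite !(mulr0n, mulr1n, scale0r, add0r, addr0).
    rewrite (@jacobian_position _ _ _ _ _ _ (2 * omega ^+ 2))// => [|j].
      by congr (row_mx _ (_ *: _)); ring.
    by rewrite dforce_self// fz scalerA; congr (_ *: _); ring.
  rewrite (@jacobian_position _ _ _ _ _ _ (- omega ^+ 2))// => [|j].
    by rewrite subrr scale0r.
  by rewrite dforce_rotJ4 fz body_rotJ4 rotJZ.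
- apply/row_matrixP => i; rewrite row_mul !row_row_mx !row0 row_mul2 !mxE.
  case: (i2 i) => ->; rewrite jacobian_velocity// ?row_V1_0 ?row_V1_1 /=.
    by rewrite mulr0 mulr1 scale0r add0r.
  by rewrite rotJ4K mulr0 mulrN1 scale0r addr0 scalerN scaleNr.
rewrite char_poly_gyroscopic.
have -> : ('X ^+ 2 - (3 * omega ^+ 2)%:P) * ('X ^+ 2 - 0%:P)
    + 'X ^+ 2 * (2 * omega)%:P ^+ 2
    = 'X ^+ 2 * ('X ^+ 2 + (omega ^+ 2)%:P) :> {poly R}.
  by rewrite !(polyCM, polyCMn, polyC0, polyC1); ring.
rewrite rmorphM rmorphXn/= map_polyX char_poly_iomega.
by rewrite !big_cons big_nil mulr1 polyC0 subr0 expr2 -mulrA.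
Qed.

Lemma spectrum_V2 m omega : m != 0 ->
  let A := jacobian (vector_field m omega) (row_mx (z0 R) 0) in
  stablemx (prodspace (V2 R) (V2 R)) A /\
  eigenvalues_on A (prodspace (V2 R) (V2 R))
    [:: (0 +i* omega)%C; (0 +i* omega)%C; (0 -i* omega)%C; (0 -i* omega)%C].
Proof.
move=> m0 A; have cf := @collision_free_z0 R.
(* A configuration of V2 is encoded by a row vector, on which J acts as the
   transpose of its matrix, that is, as - J: hence the sign. *)
have [||| //] := @eigenvalues_prodspace R 8 A (V2 R)
    (diag_mx (pt (omega ^+ 2) (omega ^+ 2))) (- (2 * omega) *: Jmx R)
    [:: (0 +i* omega)%C; (0 +i* omega)%C; (0 -i* omega)%C; (0 -i* omega)%C]
    V2_free.
- apply/row_matrixP => i; rewrite row_mul !row_row_mx !row0 row_mul2 !mxE.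
  rewrite !row_V2 (@jacobian_position _ _ _ _ _ _ 0)// => [|j]; last first.
    by rewrite scale0r dforce_config_cst.
  case: i => [[|[|//]]] ?; rewrite /= !(mulr0n, mulr1n, scale0r, add0r, addr0);
    by congr (row_mx _ (_ *: config _)); apply/funext => _;
       congr delta_mx; exact/val_inj.
- apply/row_matrixP => i.
  rewrite row_mul !row_row_mx !row0 jacobian_velocity// row_mul mul_V2.
  rewrite row_V2; congr row_mx; symmetry; apply: config_eq => j.
  rewrite bodyZ body_rotJ4 body_config /rotJ -rowE trmx_Jmx.
  by rewrite scaleNr -scalerN linearZ.
rewrite char_poly_gyroscopic.
have -> : ('X ^+ 2 - (omega ^+ 2)%:P) * ('X ^+ 2 - (omega ^+ 2)%:P)
    + 'X ^+ 2 * (- (2 * omega))%:P ^+ 2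
    = ('X ^+ 2 + (omega ^+ 2)%:P) ^+ 2 :> {poly R}.
  by rewrite !(polyCN, polyCM, polyCMn, polyC1); ring.
rewrite rmorphXn/= char_poly_iomega !big_cons big_nil.
by ring.
Qed.

End Spectrum.

Theorem mainTheorem5 (R : realType) (m omega : R) (m_gt0 : 0 < m)
    (omega_gt0 : 0 < omega) (omega_sq : omega ^+ 2 = Num.sqrt 3 / 3 + m) :
  let F := @vector_field R m omega in
  let p := row_mx (z0 R) 0 in
  let A := jacobian F p in
  let U1 := prodspace (V1 R) (V1 R) in
  let U2 := prodspace (V2 R) (V2 R) in
  let a := Num.sqrt (3 * Num.sqrt 3 + 9 * m) / 3 in
  [/\ F p = 0 /\ differentiable F p,
      \rank U1 = 4%N /\ \rank U2 = 4%N,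
      stablemx U1 A /\ stablemx U2 A,
      eigenvalues_on A U1 [:: 0; 0; (0 +i* a)%C; (0 -i* a)%C]
    & eigenvalues_on A U2
        [:: (0 +i* a)%C; (0 +i* a)%C; (0 -i* a)%C; (0 -i* a)%C]].
Proof.
move=> F p A U1 U2 a.
have m0 : m != 0 by rewrite gt_eqF.
have -> : a = omega.
  rewrite /a (_ : 3 * _ + _ = (3 * omega) ^+ 2); last first.
    by rewrite exprMn omega_sq; field.
  rewrite sqrtr_sqr ger0_norm ?mulr_ge0 ?ler0n ?ltW//.
  by rewrite mulrC mulKf// pnatr_eq0.
have Fp0 : F p = 0.
  rewrite /F /p /vector_field row_mxKl row_mxKr -[RHS]row_mx0; congr row_mx.
  apply: config_eq => i; rewrite accelerationE// force_z0 omega_sq.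
  by rewrite !body0 rotJ0 scaler0 add0r scaleNr subrr.
have [dF _] := is_diff_vector_field omega 0 m0 (@collision_free_z0 R).
have [st1 ev1] := spectrum_V1 m0 omega_sq.
have [st2 ev2] := @spectrum_V2 R m omega m0.
split=> //; split; first exact: rank_prodspace V1_free.
exact: rank_prodspace V2_free.
Qed.
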